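(* Let $a<b$ be real, $1\le m<n$ integers, and $s:\{0,\ldots,m\}\to\{0,\ldots,n\}$ injective. Then \[ \|f-D_mf\|_{[a,b]}\le \begin{cases} \|A\|_\infty\,\omega(f,b-a), & f\in C([a,b]);\\ (b-a)\,\|A\|_\infty\,\|f'\|_{[a,b]}, & f\in C^1([a,b]);\\ \tfrac12(b-a)^2\,\|A\|_\infty\,\|f''\|_{[a,b]}, & f\in C^2([a,b]). \end{cases} \]
   Context: $\|g\|_{[a,b]}=\max_{x\in[a,b]}|g(x)|$; $\omega(f,h)=\max\{|f(x)-f(y)|:x,y\in[a,b],\ |x-y|\le h\}$; $\|\cdot\|_\infty$ on matrices is the maximum absolute row sum norm. Bernstein basis on $[a,b]$: $B^m=[B^m_0,\ldots,B^m_m]$, $B_i^m(t)=\binom{m}{i}\left(\frac{b-t}{b-a}\right)^{m-i}\left(\frac{t-a}{b-a}\right)^i$. $E$ is the degree elevation matrix, $E(i,j)=\binom{n-i}{m-j}\binom{i}{j}/\binom{n}{m}$ for $0\le i\le n$, $0\le j\le m$ (zero if $i<j$ or $n-i<m-j$). $E(s,:)$ is the (invertible) matrix with entries $E(s(i),j)$, $0\le i,j\le m$, $A=E(s,:)^{-1}$, and $D^m=B^mA=[D^m_0,\ldots,D^m_m]$. With $\xi_j^n=a+\frac{j}{n}(b-a)$, the Bernstein-like operator is $D_mf=\sum_{i=0}^mf(\xi^n_{s(i)})\,D_i^m$. *)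

(* Defs.v *)
From mathcomp Require Import all_boot all_order all_algebra.
From mathcomp Require Import all_classical all_reals all_analysis.

Set Implicit Arguments.
Unset Strict Implicit.
Unset Printing Implicit Defensive.

Import Order.TTheory GRing.Theory Num.Theory.
Import numFieldNormedType.Exports.

Local Open Scope classical_set_scope.
Local Open Scope ring_scope.

(* Functions on [a, b] are represented by total functions R -> R; every notion
   below depends only on their values on [a, b]. *)

(* For g continuous on [a, b] the supremum is attained, so it is the maximum. *)
Definition unif_norm {R : realType} (a b : R) (g : R -> R) : R :=
  sup [set `|g x| | x in `[a, b]].

(* Likewise a maximum when f is continuous on [a, b] and 0 <= h. *)
Definition modulus {R : realType} (a b : R) (f : R -> R) (h : R) : R :=
  sup [set z | exists x y, [/\ x \in `[a, b], y \in `[a, b], `|x - y| <= h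
                             & z = `|f x - f y| ] ].

(* Derivative relative to [a, b]: y tends to x through points y != x of
   [a, b], so it is one-sided at the endpoints. *)
Definition derivable_on {R : realType} (a b : R) (f : R -> R) (x : R) : Prop :=
  cvg ((f y - f x) / (y - x) @[y --> within `[a, b] x^']).

Definition derive_on {R : realType} (a b : R) (f : R -> R) (x : R) : R :=
  lim ((f y - f x) / (y - x) @[y --> within `[a, b] x^']).

Fixpoint Ck_on {R : realType} (k : nat) (a b : R) (f : R -> R) : Prop :=
  match k with
  | 0 => {within `[a, b], continuous f}
  | k'.+1 => (forall x, x \in `[a, b] -> derivable_on a b f x) /\
             Ck_on k' a b (derive_on a b f)
  end.

(* The maximum absolute row sum; this is not the library's [mx_norm], which is
   the maximum absolute entry. *)
Definition row_sum_norm {R : realType} (p q : nat) (M : 'M[R]_(p, q)) : R :=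
  \big[Num.max/0]_(i < p) \sum_(j < q) `|M i j|.

Definition bernstein {R : realType} (a b : R) (m : nat) (t : R) :
    'rV[R]_m.+1 :=
  \row_(i < m.+1)
    ('C(m, i)%:R * ((b - t) / (b - a)) ^+ (m - i) * ((t - a) / (b - a)) ^+ i).

(* The vanishing cases i < j and n - i < m - j are covered by 'C(p, q) = 0 for
   p < q; the subtractions are not truncated since i <= n and j <= m. *)
Definition elevation (R : realType) (n m : nat) : 'M[R]_(n.+1, m.+1) :=
  \matrix_(i, j) (('C(n - i, m - j) * 'C(i, j))%:R / 'C(n, m)%:R).

(* For m <= n and s injective the selected rows form an invertible matrix, so
   the junk value of [invmx] on singular matrices does not arise. *)
Definition elevation_inv (R : realType) (n m : nat) (s : 'I_m.+1 -> 'I_n.+1) :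
    'M[R]_m.+1 :=
  invmx (rowsub s (elevation R n m)).

Definition bernstein_like {R : realType} (a b : R) (n m : nat)
    (s : 'I_m.+1 -> 'I_n.+1) (t : R) : 'rV[R]_m.+1 :=
  bernstein a b m t *m elevation_inv R s.

Definition node {R : realType} (a b : R) (n j : nat) : R :=
  a + j%:R / n%:R * (b - a).

Definition bernstein_like_op {R : realType} (a b : R) (n m : nat)
    (s : 'I_m.+1 -> 'I_n.+1) (f : R -> R) (t : R) : R :=
  \sum_(i < m.+1) f (node a b n (s i)) * bernstein_like a b s t 0 i.

(* Main.v *)
(* The basis functions D_i sum to 1 and reproduce affine functions, since B^m
   does and degree elevation sends the coefficients 1 and xi^m_j to 1 and
   xi^n_i; hence, for any slope c,
     f t - D_m f t = \sum_i (f t + c (xi_i - t) - f xi_i) D_i t.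
   Also \sum_i |D_i t| <= ||A||, as B^m is nonnegative with sum 1.  The summands
   are bounded with c = 0 (modulus, mean value theorem) and with c = f' t
   (Taylor with Lagrange remainder).  Reproducing affine functions needs E(s,:)
   to be invertible: a kernel vector gives a polynomial of degree at most m with
   the m + 1 roots s(i). *)
Require Import Defs.
From mathcomp Require Import all_boot all_order all_algebra.
From mathcomp Require Import all_classical all_reals all_analysis.
From mathcomp Require Import ring lra.

Import Order.TTheory GRing.Theory Num.Theory.
Import numFieldNormedType.Exports.

Local Open Scope classical_set_scope.
Local Open Scope ring_scope.

(** * Invertibility of the selected rows of the degree elevation matrix *)

Definition ffact_poly (R : comNzRingType) (k : nat) : {poly R} :=
  \prod_(l < k) ('X - (l%:R)%:P).

Lemma size_ffact_poly (R : comNzRingType) k : size (ffact_poly R k) = k.+1.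
Proof. by rewrite size_prod_XsubC /= /index_enum -enumT size_enum_ord. Qed.

Lemma horner_ffact_poly (R : comNzRingType) (k i : nat) :
  (ffact_poly R k).[i%:R] = (i ^_ k)%:R.
Proof.
rewrite /ffact_poly; elim: k => [|k IH]; first by rewrite big_ord0 hornerC.
rewrite big_ord_recr /= hornerM IH hornerXsubC ffactnSr natrM.
(* For [i < k] the natural subtraction [i - k] truncates, but the falling factorial in front of it
   is already zero. *)
by have [ki|ik] := leqP k i; [rewrite natrB | rewrite ffact_small// !mul0r].
Qed.

(* The entries of column j, up to a scalar, are the values at i = 0, ..., n of
   a polynomial in i of degree m. *)
Definition elevation_poly (R : realType) (n m j : nat) : {poly R} :=
  ((j`! * (m - j)`!)%:R)^-1 *:
    (ffact_poly R j * (ffact_poly R (m - j) \Po ((n%:R)%:P - 'X))).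

Lemma size_elevation_poly (R : realType) (n m j : nat) :
  (j <= m)%N -> (size (elevation_poly R n m j) <= m.+1)%N.
Proof.
move=> jm; apply: leq_trans (size_scale_leq _ _) _.
apply: leq_trans (size_polyMleq _ _) _.
rewrite size_comp_poly2; last by rewrite -size_polyN opprB size_XsubC.
by rewrite !size_ffact_poly addnS /= addSn subnKC.
Qed.

Lemma horner_elevation_poly (R : realType) (n m j i : nat) : (i <= n)%N ->
  (elevation_poly R n m j).[i%:R] = ('C(n - i, m - j) * 'C(i, j))%:R.
Proof.
move=> i_n; rewrite hornerZ hornerM horner_comp hornerD hornerN hornerC hornerX.
rewrite -natrB// !horner_ffact_poly -!bin_ffact !natrM.
have j0 : (j`!)%:R != 0 :> R by rewrite pnatr_eq0 -lt0n fact_gt0.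
have mj0 : ((m - j)`!)%:R != 0 :> R by rewrite pnatr_eq0 -lt0n fact_gt0.
by field; rewrite j0 mj0.
Qed.

Lemma elevationE (R : realType) (n m : nat) (i : 'I_n.+1) (j : 'I_m.+1) :
  elevation R n m i j = (elevation_poly R n m j).[i%:R] / 'C(n, m)%:R.
Proof. by rewrite mxE horner_elevation_poly// -ltnS. Qed.

(* Evaluating at i = 0, ..., m gives a triangular system with diagonal entries
   'C(n - i, m - i) > 0. *)
Lemma elevation_poly_free (R : realType) (n m : nat) (c : 'I_m.+1 -> R) :
  (m <= n)%N -> \sum_j c j *: elevation_poly R n m j = 0 -> forall j, c j = 0.
Proof.
move=> mn c0 [k]; elim/ltn_ind: k => k IH km.
set k' := Ordinal km.
have := congr1 (horner^~ k%:R) c0; rewrite horner_sum horner0 (bigD1 k')//=.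
have kn : (k <= n)%N by rewrite (leq_trans _ mn).
rewrite big1 => [|j jk].
  rewrite addr0 hornerZ horner_elevation_poly//= binn muln1 => /eqP.
  by rewrite mulf_eq0 pnatr_eq0 -leqn0 leqNgt bin_gt0 leq_sub2r// orbF => /eqP.
rewrite hornerZ horner_elevation_poly//=.
have [lt_jk|lt_kj|eq_jk] := ltngtP j k.
- have -> : j = Ordinal (ltn_ord j) by exact: val_inj.
  by rewrite IH// mul0r.
- by rewrite (bin_small lt_kj) muln0 mulr0.
- by case/eqP: jk; exact: val_inj.
Qed.

Lemma elevation_rowsub_unit (R : realType) (n m : nat) (s : 'I_m.+1 -> 'I_n.+1) :
  (m <= n)%N -> injective s -> rowsub s (elevation R n m) \in unitmx.
Proof.
(* After transposing, the row vector [v] holds the coefficients of a combination of columns that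
   vanishes on the selected rows. *)
move=> mn s_inj; rewrite -unitmx_tr -row_free_unit; apply: inj_row_free => v v0.
pose p := \sum_j v 0 j *: elevation_poly R n m j.
have Cn0 : 'C(n, m)%:R != 0 :> R by rewrite pnatr_eq0 -lt0n bin_gt0.
have p_root i : root p (s i)%:R.
  apply/eqP; move/matrixP/(_ 0 i): v0; rewrite !mxE => v0.
  apply: (mulIf (invr_neq0 Cn0)); rewrite mul0r -[RHS]v0 horner_sum mulr_suml.
  by apply: eq_bigr => j _; rewrite hornerZ -mulrA -elevationE !mxE.
have p0 : p = 0.
  apply: (@roots_geq_poly_eq0 _ _ [seq (s i)%:R | i <- enum 'I_m.+1]).
  - by apply/allP => _ /mapP[i _ ->].
  - rewrite map_inj_uniq ?enum_uniq// => i j /eqP; rewrite eqr_nat => /eqP ij.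
    by apply: s_inj; exact: val_inj.
  - rewrite size_map size_enum_ord; apply: leq_trans (size_sum _ _ _) _.
    apply/bigmax_leqP => j _; apply: leq_trans (size_scale_leq _ _) _.
    by rewrite size_elevation_poly// -ltnS.
by apply/rowP => j; rewrite mxE (elevation_poly_free _ _ _ _ mn p0).
Qed.

(** * Constants and affine functions under degree elevation and in the Bernstein basis *)

Lemma sum_elevation_row (R : realType) (n m : nat) (i : 'I_n.+1) :
  (m <= n)%N -> \sum_j elevation R n m i j = 1.
Proof.
move=> mn; under eq_bigr do rewrite mxE.
rewrite -mulr_suml -natr_sum (_ : \sum_(_ < _) _ = 'C(n, m))%N.
  by rewrite divff// pnatr_eq0 -lt0n bin_gt0.
(* Vandermonde convolution for the splitting [n = i + (n - i)]. *)
rewrite -[in RHS](subnKC (ltn_ord i : (i <= n)%N)) -binomial.Vandermonde.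
by apply: eq_bigr => j _; rewrite mulnC.
Qed.

Lemma sum_elevation_row_linear (R : realType) (n m : nat) (i : 'I_n.+1) :
  (0 < m <= n)%N ->
  \sum_(j < m.+1) elevation R n m i j * (j%:R / m%:R) = i%:R / n%:R.
Proof.
case/andP; case: m => // m _; case: n i => // n i mn.
have Cn0 : 'C(n.+1, m.+1)%:R != 0 :> R by rewrite pnatr_eq0 -lt0n bin_gt0.
have m0 : (m.+1)%:R != 0 :> R by rewrite pnatr_eq0.
have n0 : (n.+1)%:R != 0 :> R by rewrite pnatr_eq0.
under eq_bigr do rewrite mxE mulrACA -natrM -invfM.
(* Here [m] and [n] are the predecessors of the original degrees. The absorption identity turns
   [j * 'C(i, j)] into [i * 'C(i - 1, j - 1)], and Vandermonde sums the rest. *)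
rewrite -mulr_suml -natr_sum (_ : \sum_(_ < _) _ = i * 'C(n, m))%N.
  have /(congr1 (fun k => k%:R : R)) := mul_bin_diag n.+1 m; rewrite !natrM /= => e.
  apply/eqP; rewrite eqr_div ?mulf_neq0// -mulrA [_ * n.+1%:R]mulrC e.
  by rewrite [m.+1%:R * _]mulrC.
rewrite big_ord_recl muln0 add0n.
case: i => -[|i] /= i_n.
  by rewrite big1// => j _; rewrite bin0n muln0 mul0n.
have i_n' : (i <= n)%N by [].
rewrite -[in RHS](subnKC i_n') -binomial.Vandermonde big_distrr /=.
apply: eq_bigr => j _; rewrite /bump /= add1n !subSS -mulnA (mulnC 'C(i.+1, _)).
by rewrite -mul_bin_diag mulnC -mulnA.
Qed.

Lemma sum_bernstein (R : realType) (a b : R) (m : nat) (t : R) : a != b ->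
  \sum_j bernstein a b m t 0 j = 1.
Proof.
move=> ab; have ba0 : b - a != 0 by rewrite subr_eq0 eq_sym.
have -> : 1 = ((b - t) / (b - a) + (t - a) / (b - a)) ^+ m.
  by rewrite -mulrDl subrKA divff// expr1n.
rewrite exprDn; apply: eq_bigr => j _.
by rewrite mxE -mulrA mulr_natl.
Qed.

(** Absorbing [j / m] into the binomial coefficient lowers the degree by one and leaves a factor
    [(t - a) / (b - a)] in front of a partition of unity. *)
Lemma sum_bernstein_linear (R : realType) (a b : R) (m : nat) (t : R) :
  a != b -> (0 < m)%N ->
  \sum_j bernstein a b m t 0 j * (j%:R / m%:R) = (t - a) / (b - a).
Proof.
case: m => // m ab _; have ba0 : b - a != 0 by rewrite subr_eq0 eq_sym.
have m0 : (m.+1)%:R != 0 :> R by rewrite pnatr_eq0.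
rewrite big_ord_recl mul0r mulr0 add0r.
transitivity ((t - a) / (b - a) * \sum_j bernstein a b m t 0 j); last first.
  by rewrite sum_bernstein// mulr1.
rewrite mulr_sumr; apply: eq_bigr => j _; rewrite !mxE !lift0 subSS exprS.
have /(congr1 (fun k => k%:R : R)) := mul_bin_diag m.+1 j; rewrite !natrM /= => e.
have -> : ('C(m, j))%:R = j.+1%:R * 'C(m.+1, j.+1)%:R / m.+1%:R :> R.
  by rewrite -e mulrAC divff// mul1r.
by ring.
Qed.

Lemma bernstein_ge0 (R : realType) (a b : R) (m : nat) (t : R) j :
  t \in `[a, b] -> 0 <= bernstein a b m t 0 j.
Proof.
rewrite in_itv /= => /andP[a_t t_b].
have ba0 : 0 <= b - a by rewrite subr_ge0 (le_trans a_t).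
by rewrite mxE !mulr_ge0// exprn_ge0// divr_ge0// subr_ge0.
Qed.

Lemma node_in_itv (R : realType) (a b : R) (n : nat) (i : 'I_n.+1) :
  a < b -> (0 < n)%N -> node a b n i \in `[a, b].
Proof.
move=> hab n_gt0; have n0 : 0 < n%:R :> R by rewrite ltr0n.
have ba0 : 0 < b - a by rewrite subr_gt0.
have i0 : 0 <= i%:R / n%:R :> R by rewrite divr_ge0 ?ler0n.
have i1 : i%:R / n%:R <= 1 :> R by rewrite ler_pdivrMr// mul1r ler_nat -ltnS.
rewrite in_itv /= /node lerDl mulr_ge0 ?(ltW ba0)//= -lerBrDl.
by rewrite ler_piMl// ltW.
Qed.

(** * Reproduction and stability of the Bernstein-like basis *)

Section operator.
Variables (R : realType) (a b : R) (m n : nat) (s : 'I_m.+1 -> 'I_n.+1).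
Hypotheses (hab : a < b) (hm : (0 < m)%N) (hmn : (m <= n)%N).
Hypothesis hs : injective s.

(** The inverse cancels in [B^m A E(s,:) g], so identities for the [D_i] reduce to identities for
    the Bernstein basis. *)
Lemma bernstein_like_transfer (t : R) (g : 'I_m.+1 -> R) :
  \sum_i (\sum_j elevation R n m (s i) j * g j) * bernstein_like a b s t 0 i =
  \sum_j bernstein a b m t 0 j * g j.
Proof.
have : bernstein_like a b s t *m (rowsub s (elevation R n m) *m \col_j g j) =
       bernstein a b m t *m \col_j g j.
  by rewrite mulmxA mulmxKV// elevation_rowsub_unit.
move=> /matrixP/(_ 0 0); rewrite !mxE => e.
transitivity (\sum_j bernstein a b m t 0 j * (\col_j0 g j0) j 0); last first.
  by apply: eq_bigr => j _; rewrite [(\col__ _) _ _]mxE.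
rewrite -e; apply: eq_bigr => i _; rewrite mulrC; congr (_ * _).
by rewrite mxE; apply: eq_bigr => j _; rewrite !mxE.
Qed.

Lemma sum_bernstein_like (t : R) : \sum_i bernstein_like a b s t 0 i = 1.
Proof.
have /(sum_bernstein R a b m t) <- : a != b by rewrite lt_eqF.
under [RHS]eq_bigr do rewrite -[bernstein _ _ _ _ _ _]mulr1.
rewrite -bernstein_like_transfer; apply: eq_bigr => i _.
by under eq_bigr do rewrite mulr1; rewrite sum_elevation_row ?mul1r.
Qed.

Lemma sum_bernstein_like_node (t : R) :
  \sum_i node a b n (s i) * bernstein_like a b s t 0 i = t.
Proof.
have ab : a != b by rewrite lt_eqF.
have ba0 : b - a != 0 by rewrite subr_eq0 eq_sym.
rewrite /node; under eq_bigr do rewrite mulrDl mulrAC.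
rewrite big_split /= -mulr_sumr sum_bernstein_like mulr1 -mulr_suml.
under eq_bigr do rewrite -(@sum_elevation_row_linear R n m) ?hm//.
by rewrite bernstein_like_transfer sum_bernstein_linear// divfK// subrKC.
Qed.

Lemma bernstein_like_sum_le (t K : R) (g : 'I_m.+1 -> R) : t \in `[a, b] ->
  (forall i, `|g i| <= K) ->
  `|\sum_i g i * bernstein_like a b s t 0 i| <=
    row_sum_norm (elevation_inv R s) * K.
Proof.
move=> tab gK; set A := elevation_inv R s.
have K0 : 0 <= K by rewrite (le_trans _ (gK ord0)).
apply: le_trans (ler_norm_sum _ _ _) _.
have : \sum_i `|g i * bernstein_like a b s t 0 i| <=
       \sum_i \sum_j bernstein a b m t 0 j * (`|A j i| * K).
  apply: ler_sum => i _; rewrite normrM mxE.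
  apply: le_trans (ler_wpM2r (normr_ge0 _) (gK i)) _.
  under [leRHS]eq_bigr do rewrite mulrA.
  rewrite -mulr_suml mulrC ler_wpM2r//.
  apply: le_trans (ler_norm_sum _ _ _) _; apply: ler_sum => j _.
  by rewrite normrM ger0_norm// bernstein_ge0.
(* With the sum over [j] outside, each inner sum is a row sum of [A], and the Bernstein weights
   average these rows. *)
move=> /le_trans; apply; rewrite exchange_big /=.
have ab : a != b by rewrite lt_eqF.
rewrite -[leRHS]mul1r -(sum_bernstein R a b m t ab).
rewrite mulr_suml; apply: ler_sum => j _.
rewrite -mulr_sumr ler_wpM2l ?bernstein_ge0// -mulr_suml ler_wpM2r//.
exact: (le_bigmax 0 (fun i => \sum_j `|A i j|) j).
Qed.

End operator.

(** * Mean value and Taylor formulas for derivatives relative to the segment *)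

Section relative_derivative.
Variables (R : realType) (a b : R).
Implicit Types f : R -> R.

(** An interior point has a neighbourhood inside the segment, so the relative limit is the two-sided
    one. *)
Lemma derivable_on_is_derive f (x : R) : x \in `]a, b[ ->
  derivable_on a b f x -> is_derive x 1 f (derive_on a b f x).
Proof.
move=> xab fx; apply/is_derive1_caratheodory.
(* Carathéodory's slope function: the difference quotient with its gap at [x] filled by the
   limit. *)
exists (fun z => if z == x then derive_on a b f x else (f z - f x) / (z - x)).
split; last by rewrite eqxx.
  move=> z; case: eqVneq => [->|zx]; first by rewrite !subrr mulr0.
  by rewrite divfK// subr_eq0.
apply/continuous_withinNx; rewrite eqxx.
have : (f y - f x) / (y - x) @[y --> within `[a, b] x^'] --> derive_on a b f x.
  exact: fx.
move=> cv P /cv; rewrite !near_simpl !near_withinE => H.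
near=> y => yx; rewrite (negbTE yx).
suff : y \in `[a, b] by move: yx; apply: (near H y).
apply: subset_itv_oo_cc; near: y.
exact: near_in_itvoo.
Unshelve. all: by end_near. Qed.

Lemma derivable_on_continuous f :
  (forall x, x \in `[a, b] -> derivable_on a b f x) ->
  {within `[a, b], continuous f}.
Proof.
move=> df; apply/subspace_continuousP => x xab.
set F := within `[a, b] x^'.
have FF : Filter F by exact: within_filter.
have idF : (y - x) @[y --> F] --> (0 : R).
  rewrite -(subrr x); apply: cvgB; last exact: cvg_cst.
  by move=> P /= xP; apply: cvg_within; exact: nbhs_dnbhs.
have fF : f y @[y --> F] --> f x.
  have cv : (f y - f x) / (y - x) * (y - x) + f x @[y --> F] --> f x.
    rewrite -[X in _ --> X]add0r -[X in X + _](mulr0 (derive_on a b f x)).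
    by apply: cvgD (cvg_cst _); apply: cvgM idF; exact: df.
  apply: cvg_trans cv; apply: near_eq_cvg.
  rewrite /F !near_withinE; near=> y => yx _ /=.
  by rewrite divfK ?subrK// subr_eq0.
move=> P Pfx; have := fF P Pfx; rewrite !near_simpl /F !near_withinE => H.
near=> y => yab.
(* The punctured filter says nothing at [x] itself, where the claim is immediate. *)
have [->|yx] := eqVneq y x; first exact: nbhs_singleton.
by apply: (near H y).
Unshelve. all: by end_near. Qed.

(** Both orders of [x] and [y] yield the same formula. The clause [c != x] lets the Taylor argument
    cancel [c - x]. *)
Lemma MVT_between f (df : R -> R) (x y : R) :
  (forall z, z \in `]a, b[ -> is_derive z 1 f (df z)) ->
  {within `[a, b], continuous f} ->
  x \in `[a, b] -> y \in `[a, b] -> x != y ->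
  exists c, [/\ c \in `]a, b[, c != x & f y - f x = df c * (y - x)].
Proof.
move=> fd fc; rewrite !in_itv /= => /andP[ax xb] /andP[ay yb].
have mvt (u v : R) : a <= u -> v <= b -> u < v ->
    exists2 c : R, c \in `]u, v[ & f v - f u = df c * (v - u).
  move=> au vb uv.
  have fd' z : z \in `]u, v[ -> is_derive z 1 f (df z).
    rewrite in_itv /= => /andP[uz zv]; apply: fd.
    by rewrite in_itv /= (le_lt_trans au)// (lt_le_trans zv).
  have fc' : {within `[u, v], continuous f}.
    by apply: continuous_subspaceW fc; apply: subset_itv; rewrite bnd_simp.
  have [c cuv e] := @MVT R f df u v uv fd' fc'.
  exists c; [exact: cuv | exact: e].
rewrite neq_lt => /orP[xy|yx].
  have [c] := mvt _ _ ax yb xy; rewrite in_itv /= => /andP[xc cy] e.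
  by exists c; rewrite in_itv /= (le_lt_trans ax)// (lt_le_trans cy)// (gt_eqF xc).
have [c] := mvt _ _ ay xb yx; rewrite in_itv /= => /andP[yc cx] e.
exists c; rewrite in_itv /= (le_lt_trans ay)// (lt_le_trans cx)// (lt_eqF cx).
by split=> //; rewrite -opprB e -mulrN opprB.
Qed.

Lemma Ck_on_continuous k f : Ck_on k a b f -> {within `[a, b], continuous f}.
Proof. by case: k => //= k [df _]; exact: derivable_on_continuous. Qed.

Lemma derive_on_MVT f (x y : R) : Ck_on 1 a b f ->
  x \in `[a, b] -> y \in `[a, b] ->
  exists2 c, c \in `[a, b] & f y - f x = derive_on a b f c * (y - x).
Proof.
move=> fC xab yab; have [<-|xy] := eqVneq x y.
  by exists x; rewrite // !subrr mulr0.
have fd z : z \in `]a, b[ -> is_derive z 1 f (derive_on a b f z).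
  by move=> zab; apply: derivable_on_is_derive => //; apply: fC.1;
    exact: subset_itv_oo_cc.
have [c [cab _ e]] := MVT_between _ _ _ _ fd (Ck_on_continuous _ _ fC) xab yab xy.
by exists c => //; exact: subset_itv_oo_cc.
Qed.

(** Rolle's argument, then the mean value theorem for [f']. Since [x] may be an endpoint, only the
    relative derivative is used there. *)
Lemma derive_on_taylor2 f (x y : R) : Ck_on 2 a b f ->
  x \in `[a, b] -> y \in `[a, b] ->
  exists2 c, c \in `[a, b] &
    f y = f x + derive_on a b f x * (y - x) +
          2^-1 * derive_on a b (derive_on a b f) c * (y - x) ^+ 2.
Proof.
move=> fC xab yab; have [<-|xy] := eqVneq x y.
  by exists x; rewrite // subrr expr0n !mulr0 !addr0.
have [fd fC1] := fC; set f' := derive_on a b f in fC1 *.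
have yx0 : y - x != 0 by rewrite subr_eq0 eq_sym.
(* [K] is chosen so that [phi = f - p] takes equal values at [x] and [y]; a zero of its derivative
   then gives [f' c - f' x = 2 * K * (c - x)]. *)
have [K yK] : exists K, f y = f x + f' x * (y - x) + K * (y - x) ^+ 2.
  by exists ((f y - f x - f' x * (y - x)) / (y - x) ^+ 2); field.
pose p : {poly R} := f' x *: ('X - x%:P) + K *: ('X - x%:P) ^+ 2.
have pE t : p.[t] = f' x * (t - x) + K * (t - x) ^+ 2 by rewrite !hornerE.
have p'E t : p^`().[t] = f' x + 2 * K * (t - x).
  rewrite derivD !derivZ derivB derivX derivC subr0 deriv_exp derivB derivX derivC.
  by rewrite subr0 expr1 !hornerE /=; ring.
pose phi := f \- horner p.
have phid z : z \in `]a, b[ -> is_derive z 1 phi (f' z - p^`().[z]).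
  move=> zab; have fz : is_derive z 1 f (f' z).
    by apply: derivable_on_is_derive => //; apply: fd; exact: subset_itv_oo_cc.
  exact: is_deriveB fz (is_derive_poly p z).
have phic : {within `[a, b], continuous phi}.
  apply: within_continuousB; first exact: Ck_on_continuous fC.
  apply: continuous_subspaceT => t.
  exact: continuous_horner.
have [c [cab cx]] := MVT_between _ _ _ _ phid phic xab yab xy.
have -> : phi y - phi x = 0.
  by rewrite /phi /= !pE yK; ring.
move/esym/eqP; rewrite mulf_eq0 (negbTE yx0) orbF => /eqP phic0.
have [d dab e] := derive_on_MVT _ _ _ fC1 xab (subset_itv_oo_cc cab).
have cx0 : c - x != 0 by rewrite subr_eq0.
exists d => //.
have -> : derive_on a b f' d = 2 * K.
  by apply: (mulIf cx0); rewrite -e; move: phic0; rewrite p'E; lra.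
by rewrite yK; field.
Qed.

End relative_derivative.

(** * Suprema over the segment *)

Section bounds.
Variables (R : realType) (a b : R) (g : R -> R).
Hypothesis ab : a <= b.

(** Rules out the default value of [sup] on unbounded sets, for both [unif_norm] and [modulus]. *)
Lemma continuous_segment_bounded : {within `[a, b], continuous g} ->
  exists K, forall t, t \in `[a, b] -> `|g t| <= K.
Proof.
move=> gc; have [c _ cM] := EVT_max ab gc; have [d _ dM] := EVT_min ab gc.
exists (`|g c| + `|g d|) => t tab; rewrite ler_norml.
have := cM _ tab; have := dM _ tab; have := ler_norm (g c).
have := ler_norm (- g d); rewrite normrN; have := normr_ge0 (g c); have := normr_ge0 (g d).
by move=> *; apply/andP; split; lra.
Qed.

Lemma unif_norm_ge (t : R) : {within `[a, b], continuous g} ->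
  t \in `[a, b] -> `|g t| <= unif_norm a b g.
Proof.
move=> /continuous_segment_bounded[K gK] tab; apply: ub_le_sup.
  by exists K => _ [u uab <-]; exact: gK.
by exists t.
Qed.

Lemma unif_norm_le (K : R) :
  (forall t, t \in `[a, b] -> `|g t| <= K) -> unif_norm a b g <= K.
Proof.
move=> gK; apply: ge_sup.
  by exists `|g a|; exists a => //=; rewrite in_itv /= lexx.
by move=> _ [t tab <-]; exact: gK.
Qed.

Lemma modulus_ge (h x y : R) : {within `[a, b], continuous g} ->
  x \in `[a, b] -> y \in `[a, b] -> `|x - y| <= h ->
  `|g x - g y| <= modulus a b g h.
Proof.
move=> /continuous_segment_bounded[K gK] xab yab xyh; apply: ub_le_sup.
  exists (K + K) => _ [u [v [uab vab _ ->]]].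
  by rewrite (le_trans (ler_normB _ _))// lerD// gK.
by exists x, y.
Qed.

Lemma dist_segment_le (x y : R) :
  x \in `[a, b] -> y \in `[a, b] -> `|x - y| <= b - a.
Proof.
rewrite !in_itv /= ler_norml => /andP[ax xb] /andP[ay yb].
by apply/andP; split; lra.
Qed.

End bounds.

(** * The three error bounds, from one estimate with a free slope *)

Theorem theorem10p1 (R : realType) (a b : R) (hab : a < b) (m n : nat)
    (hm : (1 <= m)%N) (hmn : (m < n)%N) (s : 'I_m.+1 -> 'I_n.+1)
    (hs : injective s) (f : R -> R) :
  let err := unif_norm a b (f \- bernstein_like_op a b s f) in
  let normA := row_sum_norm (elevation_inv R s) in
  [/\ Ck_on 0 a b f -> err <= normA * modulus a b f (b - a),
      Ck_on 1 a b f ->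
        err <= (b - a) * normA * unif_norm a b (derive_on a b f)
    & Ck_on 2 a b f ->
        err <= 2^-1 * (b - a) ^+ 2 * normA *
               unif_norm a b (derive_on a b (derive_on a b f))].
Proof.
move=> err normA; have ab := ltW hab; have mn := ltnW hmn.
pose xi i := node a b n (s i); pose D t i := bernstein_like a b s t 0 i.
have xiab i : xi i \in `[a, b] by apply: node_in_itv => //; exact: leq_trans hm mn.
have sumD t : \sum_i D t i = 1 by exact: sum_bernstein_like.
have sumxiD t : \sum_i xi i * D t i = t by exact: sum_bernstein_like_node.
have errE c t : (f \- bernstein_like_op a b s f) t =
    \sum_i (f t + c * (xi i - t) - f (xi i)) * D t i.
  under eq_bigr do rewrite mulrBl mulrDl -mulrA mulrBl.
  rewrite sumrB big_split /= -!mulr_sumr sumrB -mulr_sumr sumD sumxiD.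
  by rewrite !mulr1 subrr mulr0 addr0.
(* The slope may vary with [t], which allows the tangent slope in the second-order case. *)
have err_le (c : R -> R) (K : R) :
    (forall t i, t \in `[a, b] -> `|f t + c t * (xi i - t) - f (xi i)| <= K) ->
    err <= normA * K.
  move=> fK; apply: unif_norm_le => // t tab; rewrite (errE (c t)).
  by apply: bernstein_like_sum_le => // i; exact: fK.
split=> fC.
- apply: (err_le (fun=> 0)) => t i tab; rewrite mul0r addr0.
  by apply: modulus_ge => //; exact: dist_segment_le.
- rewrite mulrAC mulrC; apply: (err_le (fun=> 0)) => t i tab.
  rewrite mul0r addr0.
  have [c cab ->] := derive_on_MVT _ _ _ _ _ _ fC (xiab i) tab.
  rewrite normrM mulrC ler_pM// ?dist_segment_le//.
  by apply: unif_norm_ge => //; case: fC.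
- rewrite mulrAC mulrC; apply: (err_le (derive_on a b f)) => t i tab.
  have [c cab ->] := derive_on_taylor2 _ _ _ _ _ _ fC tab (xiab i).
  (* The tangent line at [t] cancels, leaving minus the Lagrange remainder at [xi i]. *)
  rewrite opprD addrA subrr sub0r normrN normrM normrM normrX mulrAC.
  rewrite ger0_norm// ler_pM ?mulr_ge0 ?exprn_ge0//.
    by rewrite ler_pM2l// lerXn2r ?nnegrE ?subr_ge0// dist_segment_le.
  by apply: unif_norm_ge => //; case: fC => _ [].
Qed.
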